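(* Let $\mathcal{R}$ be a right-stable DCTRS. Then $\mathbb{U}_{seq}$ is sound for innermost derivations for $\mathcal{R}$: for every original term $u \in \mathcal{T}$ and every term $v$ over the extended signature such that there is an innermost derivation $u \rightarrow^*_{\mathbb{U}_{seq}(\mathcal{R})} v$, we have $u \rightarrow^*_{\mathcal{R}} \mathsf{tb}(v)$ (in particular $u \rightarrow^*_{\mathcal{R}} v$ if $v \in \mathcal{T}$).
   Context: Terms $\mathcal{T}=\mathcal{T}(\mathcal{F},\mathcal{V})$ over a signature $\mathcal{F}$ and a countably infinite set of variables $\mathcal{V}$. An (oriented) conditional rule has the form $l \rightarrow r \Leftarrow s_1 \rightarrow^* t_1, \ldots, s_k \rightarrow^* t_k$ ($k\ge 0$). It is deterministic if $\mathcal{V}ar(r) \subseteq \mathcal{V}ar(l) \cup \mathcal{V}ar(s_1,t_1,\ldots,s_k,t_k)$ and $\mathcal{V}ar(s_i) \subseteq \mathcal{V}ar(l, t_1, \ldots, t_{i-1})$ for all $i$. A DCTRS $\mathcal{R}$ is a set of such rules; $\mathcal{R}_u=\{l\rightarrow r \mid l \rightarrow r \Leftarrow c \in \mathcal{R}\}$. Rewrite relation: $\mathcal{R}_0=\emptyset$, $\mathcal{R}_{n+1}=\{l\sigma \rightarrow r\sigma \mid l \rightarrow r \Leftarrow s_1 \rightarrow^* t_1,\ldots \in \mathcal{R},\ s_j\sigma \rightarrow^*_{\mathcal{R}_n} t_j\sigma \text{ for all } j\}$, $\rightarrow_{\mathcal{R}}=\bigcup_n \rightarrow_{\mathcal{R}_n}$.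 $\mathcal{R}$ is right-stable if for every rule and every $i$, $t_i$ is either a linear constructor term (no root symbol of a left-hand side of $\mathcal{R}$ occurs in it) or a ground term irreducible w.r.t. $\mathcal{R}_u$, and $\mathcal{V}ar(t_i) \cap \mathcal{V}ar(l, s_1, t_1, \ldots, s_{i-1}, t_{i-1}, s_i) = \emptyset$. Sequential unraveling: for $\alpha: l \rightarrow r \Leftarrow s_1 \rightarrow^* t_1, \ldots, s_k \rightarrow^* t_k$ with $k\ge1$, let $X_i=\mathcal{V}ar(l,t_1,\ldots,t_{i-1})$ with fixed ordering $\vec{X_i}$, fresh symbols $U^\alpha_1,\dots,U^\alpha_k$, and $\mathbb{U}_{seq}(\alpha)=\{l \rightarrow U^\alpha_1(s_1,\vec{X_1})\}\cup\{U^\alpha_i(t_i,\vec{X_i}) \rightarrow U^\alpha_{i+1}(s_{i+1},\vec{X_{i+1}}) \mid 1\le i<k\}\cup\{U^\alpha_k(t_k,\vec{X_k}) \rightarrow r\}$; unconditional rules are kept unchanged. $\mathbb{U}_{seq}(\mathcal{R})=\bigcup_{\alpha}\mathbb{U}_{seq}(\alpha)$; terms over the extended signature are mixed terms. Back-translation $\mathsf{tb}$ from mixed terms to $\mathcal{T}$: $\mathsf{tb}(x)=x$; $\mathsf{tb}(f(s_1,\ldots,s_n))=f(\mathsf{tb}(s_1),\ldots,\mathsf{tb}(s_n))$ for $f\in\mathcal{F}$; $\mathsf{tb}(U^\alpha_i(w,v_1,\ldots,v_m))=l\sigma$ where $l$ is the left-hand side of $\alpha$ and $x_j\sigma=\mathsf{tb}(v_j)$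 with $x_1,\ldots,x_m=\vec{X_i}$. A derivation is innermost if each step contracts a redex no proper subterm of which is a redex. *)

(* Defs.v *)
From Stdlib Require Import Relation_Operators.
From mathcomp Require Import all_boot.
Set Implicit Arguments.
Unset Strict Implicit.
Unset Printing Implicit Defensive.

Record signature := Signature { sym : Type; arity : sym -> nat }.

(* The generated eliminator gives no induction hypotheses on the arguments, *)
(* hence the explicit term_ind below.                                       *)
Unset Elimination Schemes.
Inductive term (F : signature) (V : Type) :=
| Var (x : V)
| App (f : sym F) (a : {ffun 'I_(arity f) -> term F V}).
Set Elimination Schemes.
Arguments Var {F V} x.
Arguments App {F V} f a.

Lemma term_ind (F : signature) (V : Type) (P : term F V -> Prop)
    (hV : forall x, P (Var x))
    (hA : forall f (a : {ffun 'I_(arity f) -> term F V}),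
       (forall i, P (a i)) -> P (App f a)) :
  forall t, P t.
Proof. by fix IH 1; case=> [x|f a]; [exact: hV | apply: hA => i; exact: IH]. Qed.

(* Left-to-right sequence of variable occurrences, repetitions included. *)
Fixpoint vars (F : signature) (V : Type) (t : term F V) : seq V :=
  match t with
  | Var x => [:: x]
  | App f a => flatten [seq vars (a i) | i <- enum 'I_(arity f)]
  end.

Fixpoint subst (F : signature) (V : Type) (s : V -> term F V) (t : term F V) :
    term F V :=
  match t with
  | Var x => s x
  | App f a => App f [ffun i => subst s (a i)]
  end.

Inductive subterm (F : signature) (V : Type) (s : term F V) : term F V -> Prop :=
| subterm_refl : subterm s s
| subterm_arg f (a : {ffun 'I_(arity f) -> term F V}) i :
    subterm s (a i) -> subterm s (App f a).

Definition proper_subterm (F : signature) (V : Type) (s t : term F V) : Prop :=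
  exists f (a : {ffun 'I_(arity f) -> term F V}) i,
    t = App f a /\ subterm s (a i).

Definition ground (F : signature) (V : Type) (t : term F V) : Prop :=
  vars t = [::].

Definition linear (F : signature) (V : eqType) (t : term F V) : Prop :=
  uniq (vars t).

(* An unconditional system is a set of pairs (l, r). *)
Definition trs (F : signature) (V : Type) := term F V -> term F V -> Prop.

Inductive ctx_closure (F : signature) (V : Type) (S : trs F V) :
    term F V -> term F V -> Prop :=
| ctx_root t t' : S t t' -> ctx_closure S t t'
| ctx_arg f (a b : {ffun 'I_(arity f) -> term F V}) i :
    ctx_closure S (a i) (b i) -> (forall j, j != i -> b j = a j) ->
    ctx_closure S (App f a) (App f b).

Definition root_step (F : signature) (V : Type) (S : trs F V)
    (t t' : term F V) : Prop :=
  exists l r s, [/\ S l r, t = subst s l & t' = subst s r].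

Definition rstep (F : signature) (V : Type) (S : trs F V) :=
  ctx_closure (root_step S).

Definition redex (F : signature) (V : Type) (S : trs F V) (t : term F V) : Prop :=
  exists t', root_step S t t'.

Definition irreducible (F : signature) (V : Type) (S : trs F V)
    (t : term F V) : Prop :=
  ~ exists t', rstep S t t'.

Definition innermost_step (F : signature) (V : Type) (S : trs F V) :=
  ctx_closure (fun t t' : term F V =>
    root_step S t t' /\ forall s, proper_subterm s t -> ~ redex S s).

Definition star (T : Type) (r : T -> T -> Prop) : T -> T -> Prop :=
  clos_refl_trans T r.

(* The conditions s_j ->* t_j are the pairs (s_j, t_j). *)
Record rule (F : signature) (V : Type) := Rule {
  lhs : term F V;
  rhs : term F V;
  conds : seq (term F V * term F V) }.

(* Conditions are numbered from 0: cond_s a i and cond_t a i are s_{i+1} and *)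
(* t_{i+1} in the usual numbering 1, ..., k.                                 *)
Definition cond_s (F : signature) (V : Type) (a : rule F V)
    (i : 'I_(size (conds a))) : term F V := (tnth (in_tuple (conds a)) i).1.

Definition cond_t (F : signature) (V : Type) (a : rule F V)
    (i : 'I_(size (conds a))) : term F V := (tnth (in_tuple (conds a)) i).2.

(* The variables of l and of the first i right-hand sides t_j. *)
Definition Xvars (F : signature) (V : Type) (a : rule F V) (i : nat) : seq V :=
  vars (lhs a) ++ flatten [seq vars c.2 | c <- take i (conds a)].

Definition cvars (F : signature) (V : Type) (cs : seq (term F V * term F V)) :
    seq V :=
  flatten [seq vars c.1 ++ vars c.2 | c <- cs].

Definition deterministic (F : signature) (V : eqType) (a : rule F V) : Prop :=
  {subset vars (rhs a) <= vars (lhs a) ++ cvars (conds a)} /\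
  forall i : 'I_(size (conds a)), {subset vars (cond_s i) <= Xvars a i}.

Definition dctrs (F : signature) (V : eqType) (R : rule F V -> Prop) : Prop :=
  forall a, R a -> deterministic a.

Definition Ru (F : signature) (V : Type) (R : rule F V -> Prop) : trs F V :=
  fun l r => exists a, [/\ R a, l = lhs a & r = rhs a].

Fixpoint Rlevel (F : signature) (V : Type) (R : rule F V -> Prop) (n : nat) :
    trs F V :=
  match n with
  | 0 => fun _ _ => False
  | m.+1 => fun l r => exists a s,
      [/\ R a, l = subst s (lhs a), r = subst s (rhs a) &
          forall i : 'I_(size (conds a)),
            star (rstep (Rlevel R m)) (subst s (cond_s i)) (subst s (cond_t i))]
  end.

Definition cstep (F : signature) (V : Type) (R : rule F V -> Prop)
    (t t' : term F V) : Prop :=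
  exists n, rstep (Rlevel R n) t t'.

Definition defined_sym (F : signature) (V : Type) (R : rule F V -> Prop)
    (f : sym F) : Prop :=
  exists a args, R a /\ lhs a = App f args.

Definition constructor_term (F : signature) (V : Type) (R : rule F V -> Prop)
    (t : term F V) : Prop :=
  forall f args, subterm (App f args) t -> ~ defined_sym R f.

Definition right_stable (F : signature) (V : eqType) (R : rule F V -> Prop) :
    Prop :=
  forall a, R a -> forall i : 'I_(size (conds a)),
    ((linear (cond_t i) /\ constructor_term R (cond_t i)) \/
     (ground (cond_t i) /\ irreducible (Ru R) (cond_t i))) /\
    forall x, x \in vars (cond_t i) ->
      x \notin vars (lhs a) ++ cvars (take i (conds a)) ++ vars (cond_s i).

(* A choice, for every rule and every i, of an ordering of the set X_i. *)
Record var_ordering (F : signature) (V : eqType) := VarOrdering {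
  xs : forall a : rule F V, 'I_(size (conds a)) -> seq V;
  xs_uniq : forall (a : rule F V) (i : 'I_(size (conds a))), uniq (xs i);
  xs_mem : forall (a : rule F V) (i : 'I_(size (conds a))), xs i =i Xvars a i }.

(* U^a_i is available for every rule a over F, not only for those of a given *)
(* system R: the terms reachable from original terms by the unraveling of R  *)
(* only contain the symbols U^a_i with R a.                                  *)
Inductive usym (F : signature) (V : Type) :=
| Orig (f : sym F)
| USym (a : rule F V) (i : 'I_(size (conds a))).
Arguments Orig {F V} f.
Arguments USym {F V} a i.

Definition usig (F : signature) (V : eqType) (o : var_ordering F V) : signature :=
  {| sym := usym F V;
     arity := fun g => match g with
                       | Orig f => arity f
                       | USym a i => (size (xs o i)).+1
                       end |}.

Fixpoint emb (F : signature) (V : eqType) (o : var_ordering F V) (t : term F V) :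
    term (usig o) V :=
  match t with
  | Var x => Var x
  | App f a => @App (usig o) V (Orig f) [ffun i => emb o (a i)]
  end.

(* U^a_i(w, X_i) *)
Definition uterm (F : signature) (V : eqType) (o : var_ordering F V)
    (a : rule F V) (i : 'I_(size (conds a))) (w : term (usig o) V) :
    term (usig o) V :=
  @App (usig o) V (USym a i)
    [ffun j : 'I_(size (xs o i)).+1 => nth w (w :: [seq Var x | x <- xs o i]) j].

Inductive Useq (F : signature) (V : eqType) (o : var_ordering F V)
    (R : rule F V -> Prop) : trs (usig o) V :=
| Useq_uncond a : R a -> conds a = [::] ->
    Useq R (emb o (lhs a)) (emb o (rhs a))
| Useq_first a (i : 'I_(size (conds a))) : R a -> i = 0 :> nat ->
    Useq R (emb o (lhs a)) (uterm i (emb o (cond_s i)))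
| Useq_next a (i j : 'I_(size (conds a))) : R a -> j = i.+1 :> nat ->
    Useq R (uterm i (emb o (cond_t i))) (uterm j (emb o (cond_s j)))
| Useq_last a (i : 'I_(size (conds a))) : R a -> size (conds a) = i.+1 ->
    Useq R (uterm i (emb o (cond_t i))) (emb o (rhs a)).

(* The head case of the back-translation, on already translated arguments b; *)
(* for USym the argument 0 is dropped and the argument j+1 is the value of   *)
(* the j-th variable of X_i, which contains all variables of l.              *)
Definition tb_app (F : signature) (V : eqType) (o : var_ordering F V)
    (g : sym (usig o)) : {ffun 'I_(arity g) -> term F V} -> term F V :=
  match g return {ffun 'I_(@arity (usig o) g) -> term F V} -> term F V with
  | Orig f => fun b => App f b
  | USym a i => fun b : {ffun 'I_(size (xs o i)).+1 -> term F V} =>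
      subst (fun x => nth (Var x)
                        [seq b (lift ord0 j) | j <- enum 'I_(size (xs o i))]
                        (index x (xs o i)))
            (lhs a)
  end.

Fixpoint tb (F : signature) (V : eqType) (o : var_ordering F V)
    (t : term (usig o) V) : term F V :=
  match t with
  | Var x => Var x
  | App g a => tb_app [ffun i => tb (a i)]
  end.

(* Main.v *)
Require Import Defs.
From Stdlib Require Import Relation_Operators.
From mathcomp Require Import all_boot.
Set Implicit Arguments.
Unset Strict Implicit.
Unset Printing Implicit Defensive.

(** In an innermost derivation from an original term, the arguments [X_i] of a
    symbol [U_i] are instantiated by normal forms when they are created, hence
    never change afterwards. Every subterm [U_i(w, X_i s)] therefore remembers
    the substitution [s] with which the simulation of the rule started, and one
    can maintain the invariant that, after back-translation, the first [i - 1]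
    conditions hold for [s] and [s_i s] rewrites to [w]. When the last [U]-symbol
    is eliminated, the invariant yields the conditions of the rule. The only
    exception is a rule whose left-hand side is a variable; then every term is a
    redex and no [U]-symbol is ever eliminated by an innermost step. *)

Section Star.
Variables (T T' : Type) (r : T -> T -> Prop) (r' : T' -> T' -> Prop).

Lemma star_map (f : T -> T') :
  (forall x y, r x y -> r' (f x) (f y)) ->
  forall x y, star r x y -> star r' (f x) (f y).
Proof.
move=> H x y; elim=> [z z' /H|z|z1 z2 z3 _ h1 _ h2].
- exact: rt_step.
- exact: rt_refl.
- exact: rt_trans h1 h2.
Qed.

End Star.

(** * Normal forms and the levels of conditional rewriting *)

Section Terms.
Variables (F : signature) (V : eqType).
Implicit Types (t : term F V) (s : V -> term F V) (S : trs F V).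

Lemma mem_vars_App x (f : sym F) (a : {ffun 'I_(arity f) -> term F V}) :
  reflect (exists i, x \in vars (a i)) (x \in vars (App f a)).
Proof.
apply: (iffP flatten_mapP) => [[i _ xi]|[i xi]]; first by exists i.
by exists i; rewrite ?mem_enum.
Qed.

Lemma eq_subst s s' t : {in vars t, s =1 s'} -> subst s t = subst s' t.
Proof.
elim: t => [x|f a IH] H /=; first by apply: H; rewrite mem_head.
congr App; apply/ffunP=> i; rewrite !ffunE; apply: IH => x xi.
by apply: H; apply/mem_vars_App; exists i.
Qed.

Lemma subst_Var t : subst Var t = t.
Proof.
elim: t => [//|f a IH] /=; congr App; apply/ffunP=> i.
by rewrite ffunE IH.
Qed.

Lemma ctx_closure_mono S S' : (forall t t', S t t' -> S' t t') ->
  forall t t', ctx_closure S t t' -> ctx_closure S' t t'.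
Proof.
move=> H t t'; elim=> [u u' /H|f a b i _ IH E]; first exact: ctx_root.
exact: ctx_arg IH E.
Qed.

Lemma rstep_mono S S' : (forall t t', S t t' -> S' t t') ->
  forall t t', rstep S t t' -> rstep S' t t'.
Proof.
move=> H; apply: ctx_closure_mono => t t' [l [r [s [Slr -> ->]]]].
by exists l, r, s; split=> //; apply: H.
Qed.

(** Phrased by subterms rather than by steps, because the innermost condition on a contracted redex
    yields exactly this for its arguments. *)
Definition normal S t := forall t', subterm t' t -> ~ redex S t'.

Lemma normal_innermost S t t' : normal S t -> ~ innermost_step S t t'.
Proof.
move=> N H; elim: H N => [u u' [uu' _] N|f a b i _ IH _ N].
  by apply: (N u); [exact: subterm_refl | exists u'].
by apply: IH => u ui; apply: N; apply: subterm_arg ui.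
Qed.

Variable R : rule F V -> Prop.

Lemma Rlevel_mono m n : m <= n ->
  forall t t', Rlevel R m t t' -> Rlevel R n t t'.
Proof.
elim: m n => [//|m IH] [//|n] /IH {}IH t t' /= [a [s [Ra -> -> H]]].
exists a, s; split=> // i; apply: (star_map (f := id) _ (H i)).
exact: rstep_mono.
Qed.

Lemma star_rstep_mono m n t t' : m <= n ->
  star (rstep (Rlevel R m)) t t' -> star (rstep (Rlevel R n)) t t'.
Proof.
move=> mn; apply: (star_map (f := id)).
exact/rstep_mono/Rlevel_mono.
Qed.

Lemma star_cstep_level t t' :
  star (cstep R) t t' -> exists n, star (rstep (Rlevel R n)) t t'.
Proof.
elim=> [u u' [n un]|u|u1 u2 u3 _ [m hm] _ [n hn]].
- by exists n; apply: rt_step.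
- by exists 0; apply: rt_refl.
- exists (maxn m n); apply: (rt_trans _ _ _ u2).
    exact: star_rstep_mono (leq_maxl _ _) hm.
  exact: star_rstep_mono (leq_maxr _ _) hn.
Qed.

(** Each condition holds at a level of its own; the finitely many levels have a maximum, and the
    rule fires one level above it. *)
Lemma cstep_rule a s : R a ->
  (forall i : 'I_(size (conds a)),
     star (cstep R) (subst s (cond_s i)) (subst s (cond_t i))) ->
  cstep R (subst s (lhs a)) (subst s (rhs a)).
Proof.
move=> Ra H.
have [n hn] := fin_all_exists (fun i => star_cstep_level (H i)).
exists (\max_i n i).+1; apply: ctx_root.
(* Pairs in [Rlevel] are already instantiated, so the identity substitution matches them. *)
exists (subst s (lhs a)), (subst s (rhs a)), Var; rewrite !subst_Var; split=> //.
exists a, s; split=> // i.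
exact: star_rstep_mono (leq_bigmax i) (hn i).
Qed.

(** Arguments are rewritten one position at a time: in [c e] the positions listed in [e] are
    done. *)
Lemma star_cstep_App (f : sym F) (a b : {ffun 'I_(arity f) -> term F V}) :
  (forall i, star (cstep R) (a i) (b i)) ->
  star (cstep R) (App f a) (App f b).
Proof.
move=> H; pose c (e : seq 'I_(arity f)) :=
  [ffun i => if i \in e then b i else a i].
suff cP e : star (cstep R) (App f a) (App f (c e)).
  have -> : b = c (enum 'I_(arity f)); last exact: cP.
  by apply/ffunP=> i; rewrite ffunE mem_enum.
elim: e => [|i e IH].
  have -> : c [::] = a by apply/ffunP=> i; rewrite ffunE.
  exact: rt_refl.
apply: rt_trans IH _.
pose upd t := [ffun j => if j == i then t else c e j].
have -> : c e = upd (c e i).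
  by apply/ffunP=> j; rewrite [RHS]ffunE; case: eqP => [->|].
have -> : c (i :: e) = upd (b i).
  by apply/ffunP=> j; rewrite !ffunE inE; case: eqP => [->|].
apply: (star_map (r := cstep R) (f := fun t => App f (upd t))) => [t t' [n tt']|].
  exists n; apply: (ctx_arg (i := i)); first by rewrite !ffunE eqxx.
  by move=> j ji; rewrite !ffunE (negPf ji).
(* If [i] already occurs in [e], the position holds [b i] and nothing is left to rewrite. *)
by rewrite ffunE; case: ifP => _; [exact: rt_refl | exact: H].
Qed.

Lemma star_cstep_subst s s' t : (forall x, star (cstep R) (s x) (s' x)) ->
  star (cstep R) (subst s t) (subst s' t).
Proof.
move=> H; elim: t => [x|f a IH] /=; first exact: H.
by apply: star_cstep_App => i; rewrite !ffunE.
Qed.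

End Terms.

(** * The variable sets X_i of a rule *)

Section Xvars.
Variables (F : signature) (V : eqType) (a : rule F V).
Implicit Types i j : 'I_(size (conds a)).

Lemma vars_lhs_Xvars n : {subset vars (lhs a) <= Xvars a n}.
Proof. by move=> x xl; rewrite mem_cat xl. Qed.

Lemma XvarsS i : Xvars a i.+1 = Xvars a i ++ vars (cond_t i).
Proof.
rewrite /Xvars /cond_t (tnth_nth (lhs a, lhs a)) /= (take_nth (lhs a, lhs a)) //.
by rewrite map_rcons flatten_rcons catA.
Qed.

Lemma leq_Xvars m n : m <= n -> {subset Xvars a m <= Xvars a n}.
Proof.
move=> mn x; rewrite -(subnKC mn) /Xvars takeD map_cat flatten_cat catA.
by rewrite [in X in _ -> X]mem_cat => ->.
Qed.

Lemma vars_cond_t_Xvars i n : i < n -> {subset vars (cond_t i) <= Xvars a n}.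
Proof. by move=> /leq_Xvars iX x xi; apply: iX; rewrite XvarsS mem_cat xi orbT. Qed.

Lemma vars_cond_s_Xvars i n : deterministic a -> i <= n ->
  {subset vars (cond_s i) <= Xvars a n}.
Proof. by move=> [_ D] /leq_Xvars iX x /D /iX. Qed.

(** By determinism the variables of each s_i come from l and earlier t_j, so the s_i contribute
    nothing new to r. *)
Lemma vars_rhs_Xvars : deterministic a ->
  {subset vars (rhs a) <= Xvars a (size (conds a))}.
Proof.
move=> D x /(proj1 D); rewrite mem_cat => /orP[/vars_lhs_Xvars //|].
case/flattenP=> _ /(nthP [::])[k + <-]; rewrite size_map => ks.
have := vars_cond_t_Xvars (ltn_ord (Ordinal ks)).
have := vars_cond_s_Xvars D (ltnW (ltn_ord (Ordinal ks))).
rewrite /cond_s /cond_t !(tnth_nth (lhs a, lhs a)) /= => Xs Xt.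
by rewrite (nth_map (lhs a, lhs a)) // mem_cat => /orP[/Xs|/Xt].
Qed.

End Xvars.

(** * Mixed terms, back-translation and the invariant *)

Section Mixed.
Variables (F : signature) (V : eqType) (o : var_ordering F V).
Variable R : rule F V -> Prop.
Hypothesis R_dctrs : dctrs R.
Notation mterm := (term (usig o) V).
Notation U := (Useq (o := o) R).
Implicit Types (t : term F V) (m w : mterm) (s : V -> mterm).

Definition cargs (a : rule F V) (i : 'I_(size (conds a))) (w : mterm) s :
    {ffun 'I_(size (xs o i)).+1 -> mterm} :=
  [ffun j : 'I_(size (xs o i)).+1 => nth w (w :: [seq s x | x <- xs o i]) j].

Lemma subst_uterm (a : rule F V) (i : 'I_(size (conds a))) w s :
  subst s (uterm i w) = @App (usig o) V (USym a i) (cargs i (subst s w) s).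
Proof.
congr App; apply/ffunP=> -[[|j] jx]; rewrite !ffunE //=.
(* [V] may be empty, but [nth_map] needs a default; a position inside the ordering supplies one. *)
have x0 := tnth (in_tuple (xs o i)) (Ordinal (jx : j < _)).
by rewrite !(nth_map x0).
Qed.

Lemma cargs0 (a : rule F V) (i : 'I_(size (conds a))) w s :
  cargs i w s ord0 = w.
Proof. by rewrite ffunE. Qed.

Lemma cargsS (a : rule F V) (i : 'I_(size (conds a))) w s
    (j : 'I_(size (xs o i))) :
  cargs i w s (lift ord0 j) = s (tnth (in_tuple (xs o i)) j).
Proof.
rewrite ffunE lift0 /=; have x0 := tnth (in_tuple (xs o i)) j.
by rewrite (nth_map x0) // (tnth_nth x0).
Qed.

Lemma mem_xsP (a : rule F V) (i : 'I_(size (conds a))) x :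
  reflect (exists j, x = tnth (in_tuple (xs o i)) j) (x \in Xvars a i).
Proof. by rewrite -(xs_mem o); apply: (iffP (tnthP (in_tuple _) _)). Qed.

Lemma tb_subst s t : tb (subst s (emb o t)) = subst (fun x => tb (s x)) t.
Proof.
elim: t => [//|f a IH] /=; congr App; apply/ffunP=> i.
by rewrite !ffunE IH.
Qed.

Lemma tb_emb t : tb (emb o t) = t.
Proof.
rewrite -[emb o t]subst_Var tb_subst; exact: subst_Var.
Qed.

(** All variables of l lie in X_i, so the node stores the whole instance of l. As [w] is forgotten,
    steps that create or advance a U-symbol vanish under [tb]. *)
Lemma tb_uterm (a : rule F V) (i : 'I_(size (conds a))) w s :
  tb (subst s (uterm i w)) = subst (fun x => tb (s x)) (lhs a).
Proof.
rewrite subst_uterm /=; apply: eq_subst => x /vars_lhs_Xvars -/(_ i).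
rewrite -(xs_mem o) -index_mem => xi.
have i0 := Ordinal xi.
rewrite (nth_map i0) ?size_enum_ord // ffunE cargsS.
by rewrite (tnth_nth x) /= nth_enum_ord // nth_index // -index_mem.
Qed.

(** A U-node substitutes its translated arguments into l, where one argument may occur several times
    or not at all; hence [star]. *)
Lemma star_tb_app (g : sym (usig o)) (a b : {ffun 'I_(arity g) -> term F V}) :
  (forall i, star (cstep R) (a i) (b i)) ->
  star (cstep R) (tb_app a) (tb_app b).
Proof.
case: g a b => [f|r i] a b H /=; first exact: star_cstep_App.
apply: star_cstep_subst => x.
case: (ltnP (index x (xs o i)) (size (xs o i))) => [xi|xi].
  by rewrite !(nth_map (Ordinal xi) (Var x)) ?size_enum_ord //; apply: H.
(* Variables outside X_i are sent to themselves on both sides. *)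
by rewrite !nth_default ?size_map -?enumT ?size_enum_ord //; apply: rt_refl.
Qed.

Lemma subterm_subst s t x : x \in vars t -> subterm (s x) (subst s (emb o t)).
Proof.
elim: t => [y|f a IH] /=; first by rewrite inE => /eqP->; apply: subterm_refl.
case/mem_vars_App=> i /IH xi; apply: (@subterm_arg (usig o) V _ (Orig f) _ i).
by rewrite !ffunE.
Qed.

Lemma subterm_trans (m1 m2 m3 : mterm) :
  subterm m1 m2 -> subterm m2 m3 -> subterm m1 m3.
Proof.
by move=> m12; elim=> // f a i _; apply: subterm_arg.
Qed.

(** This covers conditional rules too, because the first unraveled rule tests nothing. *)
Lemma redex_lhs a s : R a -> redex U (subst s (emb o (lhs a))).
Proof.
move=> Ra; case: (posnP (size (conds a))) => [/size0nil c0|c0].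
  by exists (subst s (emb o (rhs a))), (emb o (lhs a)), (emb o (rhs a)), s;
    split=> //; apply: Useq_uncond.
pose i := Ordinal c0; exists (subst s (uterm i (emb o (cond_s i)))).
by exists (emb o (lhs a)), (uterm i (emb o (cond_s i))), s; split=> //;
  apply: Useq_first.
Qed.

(* If [lhs a] is a variable, then it matches every term [m]. *)
Lemma normal_lhs_subst a s m x : R a -> ~ redex U m ->
  (forall n, proper_subterm n (subst s (emb o (lhs a))) -> ~ redex U n) ->
  x \in vars (lhs a) -> normal U (s x).
Proof.
move=> Ra mN; have := redex_lhs (fun=> m) Ra.
case: (lhs a) => [y /mN //|f e _ inn /mem_vars_App[i xi] n nx].
apply: inn; do 3!eexists; split; first reflexivity.
by rewrite !ffunE; apply: subterm_trans nx (subterm_subst _ xi).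
Qed.

(* The invariant at a node [U_i(w, X_i)]; [s] is the back-translation of the
   values of [X_i]. *)
Definition good_node (g : sym (usig o)) :
    {ffun 'I_(arity g) -> mterm} -> Prop :=
  match g return {ffun 'I_(@arity (usig o) g) -> mterm} -> Prop with
  | Orig f => fun _ => True
  | USym a i => fun e : {ffun 'I_(size (xs o i)).+1 -> mterm} =>
      (exists m, ~ redex U m) ->
      (forall j, normal U (e (lift ord0 j))) /\
      exists s : V -> term F V,
        [/\ forall j, tb (e (lift ord0 j)) = s (tnth (in_tuple (xs o i)) j),
            forall j : 'I_(size (conds a)), j < i ->
              star (cstep R) (subst s (cond_s j)) (subst s (cond_t j)) &
            star (cstep R) (subst s (cond_s i)) (tb (e ord0))]
  end.

Fixpoint good (m : mterm) : Prop :=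
  match m with
  | Var _ => True
  | App g e => (forall i, good (e i)) /\ good_node e
  end.

Lemma good_emb t : good (emb o t).
Proof. by elim: t => [//|f a IH] /=; split=> // i; rewrite ffunE. Qed.

(** An embedded term has no U-symbol, so every U-node to check lies inside the value of a
    variable. *)
Lemma good_subst s t : good (subst s (emb o t)) <-> {in vars t, forall x, good (s x)}.
Proof.
elim: t => [y|f a IH] /=.
  by split=> [gy x|]; [rewrite inE => /eqP-> | apply; rewrite mem_head].
split=> [[H _] x /mem_vars_App[i xi]|H].
  by have := H i; rewrite !ffunE => /IH; apply.
split=> // i; rewrite !ffunE; apply/IH => x xi; apply: H.
by apply/mem_vars_App; exists i.
Qed.

(** The existential substitution of [good_node] can be replaced by [tb] composed with [s]: both
    agree on X_i, which by determinism contains the variables of s_i and of all earlier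
    conditions. *)
Lemma good_uterm (a : rule F V) (i : 'I_(size (conds a))) w s : R a ->
  good (subst s (uterm i w)) <->
  [/\ good (subst s w), {in Xvars a i, forall x, good (s x)} &
      (exists m, ~ redex U m) ->
      [/\ {in Xvars a i, forall x, normal U (s x)},
          forall j : 'I_(size (conds a)), j < i ->
            star (cstep R) (subst (fun x => tb (s x)) (cond_s j))
                           (subst (fun x => tb (s x)) (cond_t j)) &
          star (cstep R) (subst (fun x => tb (s x)) (cond_s i))
                         (tb (subst s w))]].
Proof.
move=> /R_dctrs Da; rewrite subst_uterm /=; split=> [[gI gN]|[gw gX gN]].
  split; first by have := gI ord0; rewrite cargs0.
    by move=> _ /mem_xsP[j ->]; have := gI (lift ord0 j); rewrite cargsS.
  case/gN=> nX [s' [s's lt_i]]; rewrite cargs0 => eq_i.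
  have ss' : {in Xvars a i, s' =1 fun x => tb (s x)}.
    by move=> _ /mem_xsP[j ->]; rewrite -s's cargsS.
  split.
  - by move=> _ /mem_xsP[j ->]; have := nX j; rewrite cargsS.
  - move=> j ji; have sj := sub_in1 (vars_cond_s_Xvars Da (ltnW ji)) ss'.
    have tj := sub_in1 (vars_cond_t_Xvars ji) ss'.
    by rewrite -(eq_subst sj) -(eq_subst tj); apply: lt_i.
  - by rewrite -(eq_subst (sub_in1 (vars_cond_s_Xvars Da (leqnn i)) ss')).
split.
  move=> j; case: (unliftP ord0 j) => [k|] ->; last by rewrite cargs0.
  by rewrite cargsS; apply: gX; apply/mem_xsP; exists k.
case/gN=> nX lt_i eq_i; split.
  by move=> j; rewrite cargsS; apply: nX; apply/mem_xsP; exists j.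
exists (fun x => tb (s x)); split=> // [j|]; first by rewrite cargsS.
by rewrite cargs0.
Qed.

(** The arguments holding X_i are normal, so at a U-node the step happens in argument 0, where it
    prolongs the recorded reduction from s_i. *)
Lemma good_node_step (g : sym (usig o)) (e e' : {ffun 'I_(arity g) -> mterm}) i :
  good_node e -> innermost_step U (e i) (e' i) ->
  star (cstep R) (tb (e i)) (tb (e' i)) ->
  (forall j, j != i -> e' j = e j) -> good_node e'.
Proof.
case: g e e' i => [//|a k] e e' i /= gN st tbst E /gN[nX [s [s_eq lt_k eq_k]]].
case: (unliftP ord0 i) => [j|] ij; rewrite {}ij in st tbst E.
  by have := normal_innermost (nX j) st.
split=> [j|]; first by rewrite E.
exists s; split=> // [j|]; first by rewrite E.
exact: rt_trans eq_k tbst.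
Qed.

(** At the root, creating or advancing a U-symbol leaves [tb] unchanged, while an unconditional rule
    or the elimination of the last U-symbol becomes one conditional step. *)
Lemma good_step m m' : good m -> innermost_step U m m' ->
  star (cstep R) (tb m) (tb m') /\ good m'.
Proof.
move=> gm st; elim: st gm => {m m'} [m m'|g e e' i st IH E [gI gN]]; last first.
  have [tbst gi] := IH (gI i).
  split; last first.
    split; last exact: good_node_step st tbst E.
    by move=> j; case: (eqVneq j i) => [->|/E ->]; [exact: gi | exact: gI].
  rewrite /=; apply: star_tb_app => j; rewrite !ffunE.
  by case: (eqVneq j i) => [->|/E ->] //; apply: rt_refl.
(* In a contracted U-redex all subterms of the first argument are proper, hence not redexes. *)
have arg_nf (a : rule F V) (i : 'I_(size (conds a))) w s :
    (forall n, proper_subterm n (subst s (uterm i w)) -> ~ redex U n) ->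
  normal U (subst s w).
  move=> inn n nw; apply: inn; rewrite subst_uterm.
  exists (USym a i : sym (usig o)), (cargs i (subst s w) s), ord0.
  by rewrite cargs0.
case=> -[l [r [s [lr -> ->]]]].
case: lr => {l r m m'} [a Ra c0|a i Ra i0|a i j Ra ij|a i Ra sz] inn gm.
- rewrite !tb_subst; split.
    by apply: rt_step; apply: cstep_rule => // k; have := ltn_ord k; rewrite {2}c0.
  apply/good_subst => x /(vars_rhs_Xvars (R_dctrs Ra)).
  by rewrite /Xvars c0 cats0 => /((good_subst _ _).1 gm).
- rewrite tb_subst tb_uterm; split; first exact: rt_refl.
  have Xi : Xvars a i = vars (lhs a) by rewrite i0 /Xvars take0 cats0.
  move/good_subst: gm => gm; apply/good_uterm => //; rewrite Xi tb_subst; split=> //.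
    apply/good_subst => x /(vars_cond_s_Xvars (R_dctrs Ra) (leqnn _)).
    by rewrite Xi => /gm.
  (* Given a non-redex, l is not a variable, so the innermost condition makes the values of its
     variables normal. *)
  case=> m mN; split; last exact: rt_refl.
    by move=> x; apply: normal_lhs_subst Ra mN inn.
  by move=> j; rewrite i0.
- rewrite !tb_uterm; split; first exact: rt_refl.
  have nt := arg_nf _ _ _ _ inn.
  have [/good_subst gt gX] := (good_uterm _ _ _ Ra).1 gm.
  (* The normal instance of t_i is a non-redex, which unlocks the guarded part of the invariant. *)
  case; first by exists (subst s (emb o (cond_t i))); apply/nt/subterm_refl.
  rewrite tb_subst => nX lt_i eq_i.
  have gXj : {in Xvars a j, forall x, good (s x)}.
    by move=> x; rewrite ij XvarsS mem_cat => /orP[/gX|/gt].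
  apply/good_uterm => //; rewrite tb_subst; split=> //.
    by apply/good_subst => x /(vars_cond_s_Xvars (R_dctrs Ra) (leqnn _)) /gXj.
  move=> _; split; last exact: rt_refl.
    (* Variables added by t_i have values that are subterms of its normal instance. *)
    move=> x; rewrite ij XvarsS mem_cat => /orP[/nX //|xt] n nx.
    by apply: nt; apply: subterm_trans nx (subterm_subst _ xt).
  (* For [k = i], the recorded reduction from s_i has just reached the instance of t_i. *)
  move=> k; rewrite ij ltnS leq_eqVlt => /orP[/eqP/val_inj->|/lt_i] //.
- rewrite tb_uterm tb_subst.
  have nt := arg_nf _ _ _ _ inn.
  have [/good_subst gt gX] := (good_uterm _ _ _ Ra).1 gm.
  case; first by exists (subst s (emb o (cond_t i))); apply/nt/subterm_refl.
  rewrite tb_subst => nX lt_i eq_i; split.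
    apply: rt_step; apply: cstep_rule => // k; have := ltn_ord k.
    by rewrite {2}sz ltnS leq_eqVlt => /orP[/eqP/val_inj->|/lt_i].
  apply/good_subst => x /(vars_rhs_Xvars (R_dctrs Ra)).
  by rewrite {1}sz XvarsS mem_cat => /orP[/gX|/gt].
Qed.

Lemma good_star m m' : star (innermost_step U) m m' -> good m ->
  star (cstep R) (tb m) (tb m') /\ good m'.
Proof.
elim=> [n n' st gn|n gn|n1 n2 n3 _ IH1 _ IH2 /IH1[st1 /IH2[st2 g3]]].
- exact: good_step.
- by split=> //; apply: rt_refl.
- by split=> //; apply: rt_trans st1 st2.
Qed.

End Mixed.

Theorem theorem14 (F : signature) (V : countType)
    (V_infinite : forall s : seq V, exists x, x \notin s)
    (R : rule F V -> Prop) (o : var_ordering F V)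
    (R_dctrs : dctrs R) (R_right_stable : right_stable R)
    (u : term F V) (v : term (usig o) V)
    (uv : star (innermost_step (Useq (o := o) R)) (emb o u) v) :
  star (cstep R) u (tb v) /\
  (forall v0 : term F V, v = emb o v0 -> star (cstep R) u v0).
Proof.
have [] := good_star R_dctrs uv (good_emb o R u).
rewrite tb_emb => st _; split=> // v0 v0E.
by rewrite v0E tb_emb in st.
Qed.
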